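(* Let $p$ be a prime number, let $R$ be a commutative ring and let $I_0\subset R$ be a principal ideal. Let $\mathbf{R}=(R_0\to R_1\to\cdots\to R_i\to\cdots)$ be a tower of rings with $R_0=R$. Then $\mathbf{R}$ is a perfectoid tower arising from $(R,I_0)$ if and only if $R_1$ contains a principal ideal $I_1$ satisfying the following conditions. (0) For every $i\ge 0$: the induced map $R_i/I_0R_i\to R_{i+1}/I_0R_{i+1}$ is injective; $p=0$ in $R_{i+1}/I_0R_{i+1}$ and the absolute Frobenius of $R_{i+1}/I_0R_{i+1}$ factors as $R_{i+1}/I_0R_{i+1}\xrightarrow{F_i}R_i/I_0R_i\hookrightarrow R_{i+1}/I_0R_{i+1}$, where the second map is the induced injection; and $I_0(R_i)_{I_0\text{-tor}}=(0)$. (1) $I_1^p=I_0R_1$, and $R_i$ is $I_0R_i$-adically Zariskian for every $i\ge 0$. (2) For every $i\ge 0$, there exists an isomorphism of graded rings $$\Phi_i^\bullet\colon \mathrm{gr}_{I_1}^\bullet(R_{i+1})\xrightarrow{\ \cong\ }\mathrm{gr}_{I_0}^\bullet(R_i)$$ such that $F_i=\Phi_i^0\circ\pi_i$, where $\pi_i\colon R_{i+1}/I_0R_{i+1}\to R_{i+1}/I_1R_{i+1}$ is the canonical projection and $\Phi_i^0\colon R_{i+1}/I_1R_{i+1}\to R_i/I_0R_i$ is the degree-$0$ part of $\Phi_i^\bullet$.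
   Context: All rings are commutative and unital. $p$ is a fixed prime. A tower of rings is an inductive system of rings $\mathbf{R}=\{R_i,t_i\colon R_i\to R_{i+1}\}_{i\ge0}$ indexed by $\mathbb{N}$. For a ring $A$, an ideal $I\subset A$ and an $A$-module $M$, an element $x\in M$ is $I$-torsion if for every $a\in I$ there is $n>0$ with $a^nx=0$; $M_{I\text{-tor}}$ is the submodule of $I$-torsion elements. Let $\varphi_{I,M}\colon M_{I\text{-tor}}\hookrightarrow M\twoheadrightarrow M/IM$ be the natural composite. A ring $A$ is $I$-adically Zariskian if $1+I\subset A^\times$ (equivalently, $I$ is contained in the Jacobson radical of $A$). For an $A$-algebra $B$, $\mathrm{gr}_I^\bullet(B)=\bigoplus_{n\ge0}I^nB/I^{n+1}B$, a graded ring. $\varphi$ denotes the absolute Frobenius $x\mapsto x^p$ of an $\mathbb{F}_p$-algebra. Let $(R,I_0)$ be a ring with an ideal and $\mathbf{R}=\{R_i,t_i\}_{i\ge0}$ a tower of rings. $\mathbf{R}$ is a perfectoid tower arising from $(R,I_0)$ if: (a) $R_0=R$ and $p\in I_0$. (b) For every $i\ge0$, the ring homomorphism $\overline{t_i}\colon R_i/I_0R_i\to R_{i+1}/I_0R_{i+1}$ induced by $t_i$ is injective. (c) For every $i\ge0$, $\mathrm{Im}(\varphi_{R_{i+1}/I_0R_{i+1}})\subset\mathrm{Im}(\overline{t_i})$. (Given (a)–(c), there is a unique ring homomorphism $F_i\colon R_{i+1}/I_0R_{i+1}\to R_i/I_0R_i$ with $\overline{t_i}\circ F_i=\varphi$,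 called the $i$-th Frobenius projection.) (d) For every $i\ge0$, $F_i$ is surjective. (e) For every $i\ge0$, $R_i$ is $I_0R_i$-adically Zariskian. (f) $I_0$ is principal, and $R_1$ contains a principal ideal $I_1$ such that $I_1^p=I_0R_1$ and, for every $i\ge0$, $\mathrm{Ker}(F_i)=I_1(R_{i+1}/I_0R_{i+1})$. (g) For every $i\ge0$, $I_0(R_i)_{I_0\text{-tor}}=(0)$, and there exists a bijection $(F_i)_{\mathrm{tor}}\colon(R_{i+1})_{I_0\text{-tor}}\to(R_i)_{I_0\text{-tor}}$ such that $F_i\circ\varphi_{I_0,R_{i+1}}=\varphi_{I_0,R_i}\circ(F_i)_{\mathrm{tor}}$. *)

(* Defs.v *)
(* Rings are [comPzRingType]s, so the zero ring is allowed.  Ideals need not be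
   proper, which is why the quotient rings of ring_quotient.v (restricted to
   proper ideals of nontrivial rings) are only reused at the level of additive
   groups. *)
From HB Require Import structures.
From mathcomp Require Import all_boot all_algebra.
From mathcomp Require Import boolp classical_sets functions.

Set Implicit Arguments.
Unset Strict Implicit.
Unset Printing Implicit Defensive.

Import GRing.Theory.
Local Open Scope classical_set_scope.
Local Open Scope ring_scope.
Local Open Scope quotient_scope.

Definition is_ideal (A : comPzRingType) (S : set A) : Prop :=
  [/\ S 0, (forall x y, S x -> S y -> S (x + y)) &
      (forall a x, S x -> S (a * x))].

Identity Coercion set_Funclass : set >-> Funclass.

Record ideal (A : comPzRingType) := Ideal {
  ideal_set :> set A;
  ideal_isP : is_ideal ideal_set }.

Section IdealBasics.
Variable A : comPzRingType.
Implicit Types (I J : ideal A) (S : set A).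

Lemma ideal_0 I : I 0. Proof. by case: (ideal_isP I). Qed.

Lemma ideal_D I x y : I x -> I y -> I (x + y).
Proof. by case: (ideal_isP I) => _ h _; apply: h. Qed.

Lemma ideal_Ml I a x : I x -> I (a * x).
Proof. by case: (ideal_isP I) => _ _; apply. Qed.

Lemma ideal_Mr I a x : I x -> I (x * a).
Proof. by rewrite mulrC; apply: ideal_Ml. Qed.

Lemma ideal_N I x : I x -> I (- x).
Proof. by rewrite -mulN1r; apply: ideal_Ml. Qed.

Lemma ideal_B I x y : I x -> I y -> I (x - y).
Proof. by move=> Ix Iy; apply/ideal_D/ideal_N. Qed.

Lemma smallest_is_ideal S : is_ideal (smallest (@is_ideal A) S).
Proof.
split=> [|x y hx hy|a x hx] X [iX SX].
- by case: iX.
- by case: (iX) => _ h _; apply: h; [apply: hx | apply: hy].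
- by case: (iX) => _ _; apply; apply: hx.
Qed.

Definition ideal_gen S : ideal A := Ideal (smallest_is_ideal S).

Lemma ideal_genS S x : S x -> ideal_gen S x.
Proof. exact: sub_gen_smallest. Qed.

Lemma ideal_gen_sub S I : S `<=` I -> ideal_gen S `<=` I.
Proof. by apply: smallest_sub; apply: ideal_isP. Qed.

Definition principal_ideal I : Prop :=
  exists a, (I : set A) = [set a * b | b in [set: A]].

Definition ideal_prod I J : ideal A :=
  ideal_gen [set x * y | x in (I : set A) & y in (J : set A)].

Lemma setT_is_ideal : is_ideal [set: A]. Proof. by []. Qed.

Definition ideal_unit : ideal A := Ideal setT_is_ideal.

Fixpoint ideal_pow I n : ideal A :=
  if n is m.+1 then ideal_prod I (ideal_pow I m) else ideal_unit.

Lemma ideal_unitT x : ideal_unit x.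
Proof. by []. Qed.

Lemma is_ideal_preM I y : is_ideal [set x | I (x * y)].
Proof.
split=> [|x z /= hx hz|a x /= hx]; rewrite /=.
- by rewrite mul0r; apply: ideal_0.
- by rewrite mulrDl; apply: ideal_D.
- by rewrite -mulrA; apply: ideal_Ml.
Qed.

Lemma ideal_gen_mul S1 S2 I :
  (forall x y, S1 x -> S2 y -> I (x * y)) ->
  forall x y, ideal_gen S1 x -> ideal_gen S2 y -> I (x * y).
Proof.
move=> h x y hx hy.
apply: (@ideal_gen_sub S1 (Ideal (is_ideal_preM I y))) hx => z Sz /=.
rewrite mulrC.
apply: (@ideal_gen_sub S2 (Ideal (is_ideal_preM I z))) hy => w Sw /=.
by rewrite mulrC; apply: h.
Qed.

Lemma ideal_powD I m n x y :
  ideal_pow I m x -> ideal_pow I n y -> ideal_pow I (m + n)%N (x * y).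
Proof.
elim: m x y => [|m IH] x y; first by move=> _; rewrite add0n; apply: ideal_Ml.
move=> hx hy; rewrite addSn /=.
apply: (@ideal_gen_sub _ (Ideal (is_ideal_preM (ideal_pow I (m + n).+1%N) y))) hx.
move=> _ [a Ia [b Jb <-]] /=; rewrite -mulrA.
by apply: ideal_genS; exists a => //; exists (b * y) => //; apply: IH.
Qed.

Lemma ideal_pow1 I : ideal_pow I 1%N = I :> set A.
Proof.
apply/seteqP; split=> [|x Ix] /=.
  by apply: ideal_gen_sub => _ [a Ia [b _ <-]]; apply: ideal_Mr.
by apply: ideal_genS; exists x => //; exists 1; rewrite ?mulr1 //;
   apply: ideal_unitT.
Qed.

End IdealBasics.

(* The extension [I B] of an ideal [I] of [A] to the [A]-algebra [f : A -> B]. *)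
Definition ideal_ext (A B : comPzRingType) (f : A -> B) (I : ideal A) : ideal B :=
  ideal_gen (f @` I).

Lemma ideal_ext_powD (A B : comPzRingType) (f : {rmorphism A -> B})
    (I : ideal A) m n x y :
  ideal_ext f (ideal_pow I m) x -> ideal_ext f (ideal_pow I n) y ->
  ideal_ext f (ideal_pow I (m + n)%N) (x * y).
Proof.
apply: ideal_gen_mul => _ _ [a ha <-] [b hb <-]; rewrite -rmorphM.
by apply: ideal_genS; exists (a * b) => //; apply: ideal_powD.
Qed.

Section QuotientRing.
Variables (A : comPzRingType) (I : ideal A).

Definition ideal_pred : {pred A} := fun x => `[< I x >].

Lemma ideal_predE x : (x \in ideal_pred) = `[< I x >]. Proof. by []. Qed.

Lemma ideal_pred_zmod : zmod_closed ideal_pred.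
Proof.
split=> [|x y /asboolP Ix /asboolP Iy]; apply/asboolP.
  exact: ideal_0.
exact: ideal_B.
Qed.

HB.instance Definition _ :=
  GRing.isZmodClosed.Build A ideal_pred ideal_pred_zmod.

Definition quot_ring : Type := Quotient.quot ideal_pred.
HB.instance Definition _ := GRing.Zmodule.on quot_ring.

Definition quot_pi (x : A) : quot_ring := \pi_(Quotient.quot ideal_pred) x.
Definition quot_repr (x : quot_ring) : A := repr (x : Quotient.quot ideal_pred).

Lemma quot_reprK : cancel quot_repr quot_pi.
Proof. by move=> x; apply: reprK. Qed.

Lemma quot_piP x y : quot_pi x = quot_pi y <-> I (x - y).
Proof.
rewrite (rwP eqP) (rwP (asboolP (I _))) -ideal_predE Quotient.idealrBE.
by split.
Qed.

Lemma quot_piK x : I (quot_repr (quot_pi x) - x).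
Proof. by apply/quot_piP; rewrite quot_reprK. Qed.

Lemma quot_piB x y : quot_pi (x - y) = quot_pi x - quot_pi y.
Proof. exact: (raddfB \pi_(Quotient.quot ideal_pred)). Qed.

Lemma quot_piD x y : quot_pi (x + y) = quot_pi x + quot_pi y.
Proof. exact: (raddfD \pi_(Quotient.quot ideal_pred)). Qed.

Definition quot_mul (x y : quot_ring) : quot_ring :=
  quot_pi (quot_repr x * quot_repr y).

Lemma quot_piM x y : quot_pi (x * y) = quot_mul (quot_pi x) (quot_pi y).
Proof.
apply/esym/quot_piP; set a := quot_repr _; set b := quot_repr _.
have -> : a * b - x * y = (a - x) * b + x * (b - y).
  by rewrite mulrBl mulrBr addrA subrK.
by apply: ideal_D; [apply/ideal_Mr/quot_piK | apply/ideal_Ml/quot_piK].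
Qed.

Lemma quot_mulA : associative quot_mul.
Proof.
move=> x y z; rewrite -[x]quot_reprK -[y]quot_reprK -[z]quot_reprK.
by rewrite -!quot_piM mulrA.
Qed.

Lemma quot_mulC : commutative quot_mul.
Proof. by move=> x y; rewrite /quot_mul mulrC. Qed.

Lemma quot_mul1 : left_id (quot_pi 1) quot_mul.
Proof. by move=> x; rewrite -[x]quot_reprK -quot_piM mul1r. Qed.

Lemma quot_mulD : left_distributive quot_mul +%R.
Proof.
move=> x y z; rewrite -[x]quot_reprK -[y]quot_reprK -[z]quot_reprK.
by rewrite -quot_piD -!quot_piM mulrDl quot_piD.
Qed.

HB.instance Definition _ := GRing.Zmodule_isComPzRing.Build quot_ring
  quot_mulA quot_mulC quot_mul1 quot_mulD.

HB.instance Definition _ := GRing.isZmodMorphism.Build A quot_ring quot_pi quot_piB.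

Lemma quot_pi_monoid : monoid_morphism quot_pi.
Proof. by split=> // x y; apply: quot_piM. Qed.

HB.instance Definition _ :=
  GRing.isMonoidMorphism.Build A quot_ring quot_pi quot_pi_monoid.

End QuotientRing.

(* The map [A/I -> B/J] induced by [f], meaningful when [f] sends [I] into [J]
   (see [quot_mapE]).  For [f] the identity this is the canonical projection. *)
Definition quot_map (A B : comPzRingType) (I : ideal A) (J : ideal B)
  (f : A -> B) (x : quot_ring I) : quot_ring J := quot_pi J (f (quot_repr x)).

Lemma quot_mapE (A B : comPzRingType) (I : ideal A) (J : ideal B)
    (f : {rmorphism A -> B}) :
  (forall x, I x -> J (f x)) ->
  forall x, quot_map J f (quot_pi I x) = quot_pi J (f x).
Proof. by move=> h x; apply/quot_piP; rewrite -rmorphB; apply/h/quot_piK. Qed.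

Definition quot_proj (A : comPzRingType) (I J : ideal A) :
  quot_ring I -> quot_ring J := quot_map J idfun.

(* A (commutative, nonnegatively) graded ring is given by its homogeneous
   pieces; equalities between pieces of propositionally equal degrees are
   stated in the total space of homogeneous elements. *)
Record gradedRing := GradedRing {
  gr_piece :> nat -> zmodType;
  gr_one : gr_piece 0%N;
  gr_mul : forall m n, gr_piece m -> gr_piece n -> gr_piece (m + n)%N;
  gr_mulDl : forall m n (x y : gr_piece m) (z : gr_piece n),
    gr_mul (x + y) z = gr_mul x z + gr_mul y z;
  gr_mulDr : forall m n (x : gr_piece m) (y z : gr_piece n),
    gr_mul x (y + z) = gr_mul x y + gr_mul x z;
  gr_mulA : forall l m n (x : gr_piece l) (y : gr_piece m) (z : gr_piece n),
    Tagged gr_piece (gr_mul x (gr_mul y z)) =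
    Tagged gr_piece (gr_mul (gr_mul x y) z);
  gr_mulC : forall m n (x : gr_piece m) (y : gr_piece n),
    Tagged gr_piece (gr_mul x y) = Tagged gr_piece (gr_mul y x);
  gr_mul1 : forall n (x : gr_piece n), gr_mul gr_one x = x }.

Record gradedIso (G H : gradedRing) := GradedIso {
  giso_map :> forall n, {additive G n -> H n};
  giso_bij : forall n, bijective (giso_map n);
  giso_one : giso_map 0%N (gr_one G) = gr_one H;
  giso_mul : forall m n (x : G m) (y : G n),
    giso_map (m + n)%N (gr_mul x y) = gr_mul (giso_map m x) (giso_map n y) }.

Section SubQuotient.
Variables (B : comPzRingType) (J K : ideal B).

Record ideal_type := IdealElt {
  ideal_val :> B;
  ideal_valP : ideal_val \in ideal_pred J }.
HB.instance Definition _ := [isSub for ideal_val].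
HB.instance Definition _ := [Choice of ideal_type by <:].
HB.instance Definition _ := [SubChoice_isSubZmodule of ideal_type by <:].

Definition ideal_trace : {pred ideal_type} := fun u => val u \in ideal_pred K.

Lemma ideal_trace_zmod : zmod_closed ideal_trace.
Proof.
split=> [|u v Ku Kv]; rewrite /in_mem /= /ideal_trace.
  by rewrite raddf0 rpred0.
by rewrite raddfB rpredB.
Qed.

HB.instance Definition _ :=
  GRing.isZmodClosed.Build ideal_type ideal_trace ideal_trace_zmod.

(* [J / (J `&` K)], used for ideals [K] contained in [J]. *)
Definition subquot : zmodType := Quotient.quot ideal_trace.

Definition subquot_pi (x : B) (Jx : J x) : subquot :=
  \pi_(Quotient.quot ideal_trace) (IdealElt (asboolT Jx)).

Definition subquot_repr (u : subquot) : B :=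
  val (repr (u : Quotient.quot ideal_trace)).

Lemma subquot_reprP u : J (subquot_repr u).
Proof. by apply/asboolP; apply: (ideal_valP (repr (u : Quotient.quot ideal_trace))). Qed.

Lemma subquot_reprK u (Ju : J (subquot_repr u)) : subquot_pi Ju = u.
Proof.
by rewrite -[RHS]reprK /subquot_pi; congr \pi; apply: val_inj.
Qed.

Lemma subquot_piP x y (Jx : J x) (Jy : J y) :
  subquot_pi Jx = subquot_pi Jy <-> K (x - y).
Proof.
rewrite (rwP eqP) (rwP (asboolP (K _))) /subquot_pi -Quotient.idealrBE.
by split.
Qed.

Lemma subquot_piK x (Jx : J x) : K (subquot_repr (subquot_pi Jx) - x).
Proof.
by apply/(subquot_piP (subquot_reprP _) Jx); rewrite subquot_reprK.
Qed.

Lemma subquot_piD x y (Jx : J x) (Jy : J y) (Jxy : J (x + y)) :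
  subquot_pi Jxy = subquot_pi Jx + subquot_pi Jy.
Proof.
by rewrite -(raddfD \pi_(Quotient.quot ideal_trace)); congr \pi; apply: val_inj.
Qed.

End SubQuotient.

Section AssociatedGraded.
Variables (A B : comPzRingType) (f : {rmorphism A -> B}) (I : ideal A).

Local Notation IB n := (ideal_ext f (ideal_pow I n)).

Definition agr_piece (n : nat) : zmodType := subquot (IB n) (IB n.+1).

Lemma agr_one_subproof : IB 0%N 1.
Proof. by rewrite -(rmorph1 f); apply: ideal_genS; exists 1 => //; apply: ideal_unitT. Qed.

Definition agr_one : agr_piece 0%N := subquot_pi (IB 1%N) agr_one_subproof.

Definition agr_mul m n (u : agr_piece m) (v : agr_piece n) : agr_piece (m + n)%N :=
  subquot_pi (IB (m + n).+1%N)
    (ideal_ext_powD (subquot_reprP u) (subquot_reprP v)).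

Lemma agr_mulE m n x y (hx : IB m x) (hy : IB n y) (hxy : IB (m + n)%N (x * y)) :
  agr_mul (subquot_pi (IB m.+1) hx) (subquot_pi (IB n.+1) hy) =
  subquot_pi (IB (m + n).+1%N) hxy.
Proof.
apply/subquot_piP; set a := subquot_repr _; set b := subquot_repr _.
have -> : a * b - x * y = (a - x) * b + x * (b - y).
  by rewrite mulrBl mulrBr addrA subrK.
apply: ideal_D; first by
  rewrite -addSn; apply: ideal_ext_powD; [apply: subquot_piK | apply: subquot_reprP].
by rewrite -addnS; apply: ideal_ext_powD => //; apply: subquot_piK.
Qed.

Lemma agr_Tagged m n x y (hx : IB m x) (hy : IB n y) :
  m = n -> x = y ->
  Tagged agr_piece (subquot_pi (IB m.+1) hx : agr_piece m) =
  Tagged agr_piece (subquot_pi (IB n.+1) hy : agr_piece n).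
Proof.
move=> emn exy; subst n; subst y; congr (Tagged _ _).
by apply/subquot_piP; rewrite subrr; apply: ideal_0.
Qed.

Lemma agr_mulDl m n (x y : agr_piece m) (z : agr_piece n) :
  agr_mul (x + y) z = agr_mul x z + agr_mul y z.
Proof.
have hx := subquot_reprP x; have hy := subquot_reprP y.
have hz := subquot_reprP z; have hxy := ideal_D hx hy.
rewrite -[x](subquot_reprK hx) -[y](subquot_reprK hy) -[z](subquot_reprK hz).
rewrite -(subquot_piD _ _ _ hxy).
have h1 := ideal_ext_powD hx hz; have h2 := ideal_ext_powD hy hz.
have h3 := ideal_ext_powD hxy hz; have h4 := ideal_D h1 h2.
rewrite (agr_mulE _ _ h1) (agr_mulE _ _ h2) (agr_mulE _ _ h3).
rewrite -(subquot_piD _ _ _ h4); apply/subquot_piP.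
by rewrite mulrDl subrr; apply: ideal_0.
Qed.

Lemma agr_mulDr m n (x : agr_piece m) (y z : agr_piece n) :
  agr_mul x (y + z) = agr_mul x y + agr_mul x z.
Proof.
have hx := subquot_reprP x; have hy := subquot_reprP y.
have hz := subquot_reprP z; have hyz := ideal_D hy hz.
rewrite -[x](subquot_reprK hx) -[y](subquot_reprK hy) -[z](subquot_reprK hz).
rewrite -(subquot_piD _ _ _ hyz).
have h1 := ideal_ext_powD hx hy; have h2 := ideal_ext_powD hx hz.
have h3 := ideal_ext_powD hx hyz; have h4 := ideal_D h1 h2.
rewrite (agr_mulE _ _ h1) (agr_mulE _ _ h2) (agr_mulE _ _ h3).
rewrite -(subquot_piD _ _ _ h4); apply/subquot_piP.
by rewrite mulrDr subrr; apply: ideal_0.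
Qed.

Lemma agr_mulA l m n (x : agr_piece l) (y : agr_piece m) (z : agr_piece n) :
  Tagged agr_piece (agr_mul x (agr_mul y z)) =
  Tagged agr_piece (agr_mul (agr_mul x y) z).
Proof.
have hx := subquot_reprP x; have hy := subquot_reprP y.
have hz := subquot_reprP z.
rewrite -[x](subquot_reprK hx) -[y](subquot_reprK hy) -[z](subquot_reprK hz).
have h1 := ideal_ext_powD hx hy; have h2 := ideal_ext_powD hy hz.
rewrite (agr_mulE _ _ h1) (agr_mulE _ _ h2).
rewrite (agr_mulE _ _ (ideal_ext_powD hx h2)).
rewrite (agr_mulE _ _ (ideal_ext_powD h1 hz)).
by apply: agr_Tagged; rewrite ?addnA ?mulrA.
Qed.

Lemma agr_mulC m n (x : agr_piece m) (y : agr_piece n) :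
  Tagged agr_piece (agr_mul x y) = Tagged agr_piece (agr_mul y x).
Proof. by apply: agr_Tagged; [apply: addnC | apply: mulrC]. Qed.

Lemma agr_mul1 n (x : agr_piece n) : agr_mul agr_one x = x.
Proof.
have hx := subquot_reprP x; rewrite -[in RHS](subquot_reprK hx).
rewrite -[in LHS](subquot_reprK hx).
rewrite (agr_mulE _ _ (ideal_ext_powD agr_one_subproof hx)).
by apply/subquot_piP; rewrite mul1r subrr; apply: ideal_0.
Qed.

(* gr_I(B), with n-th piece I^n B / I^(n+1) B. *)
Definition agr : gradedRing :=
  GradedRing agr_mulDl agr_mulDr agr_mulA agr_mulC agr_mul1.

Lemma ideal_ext_pow0 x : IB 0%N x.
Proof. by rewrite -[x]mulr1; apply: ideal_Ml; apply: agr_one_subproof. Qed.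

(* The canonical identification of B / I B with gr_I^0(B) = I^0 B / I^1 B. *)
Definition agr0_of (x : quot_ring (ideal_ext f I)) : agr 0%N :=
  subquot_pi (IB 1%N) (ideal_ext_pow0 (quot_repr x)).

Definition agr0_to (u : agr 0%N) : quot_ring (ideal_ext f I) :=
  quot_pi _ (subquot_repr u).

Lemma ideal_ext_pow1 : IB 1%N = ideal_ext f I :> set B.
Proof. by rewrite /ideal_ext ideal_pow1. Qed.

Lemma agr0_ofE x : agr0_of (quot_pi _ x) = subquot_pi (IB 1%N) (ideal_ext_pow0 x).
Proof. by apply/subquot_piP; rewrite ideal_ext_pow1; apply: quot_piK. Qed.

Lemma agr0_ofK : cancel agr0_of agr0_to.
Proof.
move=> x; rewrite -[RHS]quot_reprK; apply/quot_piP.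
by rewrite -ideal_ext_pow1; apply: subquot_piK.
Qed.

Lemma agr0_toK : cancel agr0_to agr0_of.
Proof.
move=> u; rewrite /agr0_to agr0_ofE -[RHS](subquot_reprK (subquot_reprP u)).
by apply/subquot_piP; rewrite subrr; apply: ideal_0.
Qed.

End AssociatedGraded.

(* The degree-0 part B / I B -> B' / I' B' of a graded isomorphism. *)
Definition giso_deg0 (A B A' B' : comPzRingType) (f : {rmorphism A -> B})
    (f' : {rmorphism A' -> B'}) (I : ideal A) (I' : ideal A')
    (Phi : gradedIso (agr f I) (agr f' I')) :
    quot_ring (ideal_ext f I) -> quot_ring (ideal_ext f' I') :=
  fun x => agr0_to (Phi 0%N (agr0_of x)).

Definition zariskian (A : comPzRingType) (I : ideal A) : Prop :=
  forall x, I x -> exists y, (1 + x) * y = 1.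

(* The I-torsion elements of the A-algebra [f : A -> B], seen as an A-module. *)
Definition torsion (A B : comPzRingType) (f : A -> B) (I : ideal A) : set B :=
  [set x | forall a, I a -> exists2 n, (0 < n)%N & f (a ^+ n) * x = 0].

Record tower := Tower {
  tower_ring :> nat -> comPzRingType;
  tower_trans : forall i, {rmorphism tower_ring i -> tower_ring i.+1} }.

(* The tower R_1 -> R_2 -> ..., which makes every R_(i+1) an R_1-algebra. *)
Definition tower_shift (T : tower) : tower :=
  @Tower (fun i => T i.+1) (fun i => tower_trans T i.+1).

Fixpoint tower_map (T : tower) (i : nat) : {rmorphism T 0%N -> T i} :=
  match i with
  | 0 => idfun
  | j.+1 => tower_trans T j \o tower_map T j
  end.

Definition tower_map1 (T : tower) (i : nat) : {rmorphism T 1%N -> T i.+1} :=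
  tower_map (tower_shift T) i.

Section TowerQuotients.
Variables (T : tower) (I0 : ideal (T 0%N)).

Definition tower_ideal i : ideal (T i) := ideal_ext (tower_map T i) I0.

Definition tower_quot i : comPzRingType := quot_ring (tower_ideal i).

Definition tower_bar i : tower_quot i -> tower_quot i.+1 :=
  quot_map (tower_ideal i.+1) (tower_trans T i).

Lemma tower_idealS i x : tower_ideal i x -> tower_ideal i.+1 (tower_trans T i x).
Proof.
move=> hx; pose P := [set x | tower_ideal i.+1 (tower_trans T i x)].
have iP : is_ideal P.
  split=> [|y z|a y]; rewrite /P /=.
  - by rewrite rmorph0; apply: (ideal_0 (tower_ideal i.+1)).
  - by rewrite rmorphD; apply: (@ideal_D _ (tower_ideal i.+1)).
  - by rewrite rmorphM; apply: (@ideal_Ml _ (tower_ideal i.+1)).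
apply: (@ideal_gen_sub _ _ (Ideal iP)) hx => _ [a Ia <-] /=.
by apply: ideal_genS; exists a.
Qed.

Lemma tower_barE i x :
  tower_bar (quot_pi (tower_ideal i) x) =
  quot_pi (tower_ideal i.+1) (tower_trans T i x).
Proof. by apply: quot_mapE => y; apply: tower_idealS. Qed.

Lemma tower_bar_zmod i : zmod_morphism (@tower_bar i).
Proof.
move=> x y; rewrite -[x]quot_reprK -[y]quot_reprK -rmorphB.
by rewrite !tower_barE !rmorphB.
Qed.

Lemma tower_bar_monoid i : monoid_morphism (@tower_bar i).
Proof.
split=> [|x y]; first by rewrite -(rmorph1 (quot_pi _)) tower_barE !rmorph1.
rewrite -[x]quot_reprK -[y]quot_reprK -rmorphM.
by rewrite !tower_barE !rmorphM.
Qed.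

HB.instance Definition _ i := GRing.isZmodMorphism.Build
  (tower_quot i) (tower_quot i.+1) (@tower_bar i) (@tower_bar_zmod i).
HB.instance Definition _ i := GRing.isMonoidMorphism.Build
  (tower_quot i) (tower_quot i.+1) (@tower_bar i) (@tower_bar_monoid i).

(* phi_(I_0, R_i) is the restriction of this map to [tower_torsion I0 i]. *)
Definition tower_pi i : T i -> tower_quot i := quot_pi (tower_ideal i).

Definition tower_torsion i : set (T i) := torsion (tower_map T i) I0.
Arguments tower_torsion : clear implicits.

Definition torsion_killed i : Prop :=
  forall a x, I0 a -> tower_torsion i x -> tower_map T i a * x = 0.

End TowerQuotients.
Arguments tower_torsion {T} I0 i.

(* The zero ring is not excluded, hence [pFrobenius_aut] does not apply. *)
Lemma exprD_char0 (A : comPzRingType) p (x y : A) :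
  prime p -> p%:R = 0 :> A -> (x + y) ^+ p = x ^+ p + y ^+ p.
Proof.
move=> pp p0; rewrite exprDn; case: p pp p0 => // p pp p0.
rewrite big_ord_recl big_ord_recr /= bin0 binn subn0 subnn !expr0 mulr1 mul1r.
rewrite big1 ?add0r // => j _.
have /dvdnP[k ->] : (p.+1 %| 'C(p.+1, bump 0 j))%N.
  by apply: prime_dvd_bin => //; rewrite /bump /= add1n ltnS ltn_ord.
by rewrite mulrnA -[LHS]mulr_natl p0 mul0r.
Qed.

Lemma exprB_char0 (A : comPzRingType) p (x y : A) :
  prime p -> p%:R = 0 :> A -> (x - y) ^+ p = x ^+ p - y ^+ p.
Proof.
move=> pp p0; apply/eqP; rewrite eq_sym subr_eq -exprD_char0 //.
by rewrite subrK.
Qed.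

Section FrobeniusProjection.
Variables (p : nat) (T : tower) (I0 : ideal (T 0%N)).

Record purely_inseparable : Prop := {
  pi_p : I0 p%:R;
  pi_inj : forall i, injective (@tower_bar T I0 i);
  pi_frob : forall i,
    range (fun x : tower_quot I0 i.+1 => x ^+ p) `<=` range (@tower_bar T I0 i) }.

Hypotheses (p_pr : prime p) (H : purely_inseparable).

(* The Frobenius projection F_i, i.e. the unique map with
   [tower_bar (frob_proj x) = x ^+ p]. *)
Definition frob_proj i (x : tower_quot I0 i.+1) : tower_quot I0 i :=
  projT1 (cid2 (pi_frob H (ex_intro2 _ _ x I erefl))).

Lemma frob_projE i (x : tower_quot I0 i.+1) : tower_bar (frob_proj x) = x ^+ p.
Proof. by rewrite /frob_proj; case: cid2. Qed.

Lemma frob_proj_unique i (F : tower_quot I0 i.+1 -> tower_quot I0 i) :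
  (forall x, tower_bar (F x) = x ^+ p) -> F =1 @frob_proj i.
Proof. by move=> FE x; apply: (pi_inj H); rewrite FE frob_projE. Qed.

Lemma tower_quot_p i : p%:R = 0 :> tower_quot I0 i.
Proof.
rewrite -(rmorph_nat (quot_pi _)) -(rmorph0 (quot_pi _)).
apply/quot_piP; rewrite subr0; apply: ideal_genS.
by exists p%:R; [apply: pi_p H | rewrite rmorph_nat].
Qed.

Lemma frob_proj_zmod i : zmod_morphism (@frob_proj i).
Proof.
move=> x y; apply: (pi_inj H); rewrite rmorphB /= !frob_projE.
by apply: exprB_char0; last apply: tower_quot_p.
Qed.

Lemma frob_proj_monoid i : monoid_morphism (@frob_proj i).
Proof.
split=> [|x y]; apply: (pi_inj H); first by rewrite rmorph1 /= frob_projE expr1n.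
by rewrite rmorphM /= !frob_projE exprMn.
Qed.

End FrobeniusProjection.

(* [T] arises from the pair (R_0, I_0), R being taken to be [T 0].  In
   [pt_tor_bij], only the values of [Ftor] on torsion elements matter. *)
Record perfectoid_tower (p : nat) (T : tower) (I0 : ideal (T 0%N)) : Prop := {
  pt_pi : purely_inseparable p I0;
  pt_surj : forall i (y : tower_quot I0 i), exists x, frob_proj pt_pi x = y;
  pt_zariskian : forall i, zariskian (tower_ideal I0 i);
  pt_principal : principal_ideal I0;
  pt_I1 : exists I1 : ideal (T 1%N),
    [/\ principal_ideal I1,
        ideal_pow I1 p = tower_ideal I0 1%N :> set (T 1%N) &
        forall i, [set x : tower_quot I0 i.+1 | frob_proj pt_pi x = 0] =
          ideal_ext (@tower_pi T I0 i.+1 \o tower_map1 T i) I1];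
  pt_torsion : forall i, torsion_killed I0 i;
  pt_tor_bij : forall i, exists2 Ftor : T i.+1 -> T i,
    set_bij (tower_torsion I0 i.+1) (tower_torsion I0 i) Ftor &
    forall x, tower_torsion I0 i.+1 x ->
      frob_proj pt_pi (tower_pi I0 x) = tower_pi I0 (Ftor x) }.

(* Main.v *)
(* Fix a level, A = R_i and B = R_(i+1), and let a, b be generators of I_0, I_1.
   The I_0-torsion of A is Ann(a) and meets aA trivially, so its image in A/aA is
   a copy of it, and it is exactly the annihilator of gr^1 in gr^0; in positive
   degrees multiplication by a is injective on gr.  Hence the graded ring of A is
   determined by A/aA together with the image of the torsion, and similarly for B
   with respect to b once the torsion of B is known to be killed by b.  A graded
   isomorphism preserves the annihilator of gr^1 and so induces the bijection of
   torsion; conversely a Frobenius projection matching the torsion extends to the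
   graded isomorphism b^n x |-> a^n F(x). *)
Require Import Defs.
From HB Require Import structures.
From mathcomp Require Import all_boot all_algebra.
From mathcomp Require Import boolp classical_sets functions.

Import GRing.Theory.
Local Open Scope classical_set_scope.
Local Open Scope ring_scope.

Set Implicit Arguments.
Unset Strict Implicit.
Unset Printing Implicit Defensive.

(** * Generators of principal ideals, of their powers and of their extensions *)

Definition generates (A : comPzRingType) (a : A) (I : ideal A) : Prop :=
  (I : set A) = [set a * b | b in [set: A]].

Lemma generatesP (A : comPzRingType) (a : A) (I : ideal A) (aI : generates a I) x :
  I x <-> exists y, x = a * y.
Proof.
rewrite aI; split=> [[y _ <-]|[y ->]]; by exists y.
Qed.

Lemma multiples_is_ideal (A : comPzRingType) (a : A) :
  is_ideal [set a * b | b in [set: A]].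
Proof.
split=> [|_ _ [y _ <-] [z _ <-]|c _ [y _ <-]].
- by exists 0; rewrite ?mulr0.
- by exists (y + z); rewrite ?mulrDr.
- by exists (c * y); rewrite // mulrCA.
Qed.

Lemma ideal_gen_generates (A : comPzRingType) (S : set A) (a : A) :
  S a -> (forall x, S x -> exists y, x = a * y) -> generates a (ideal_gen S).
Proof.
move=> Sa SaA; apply/seteqP; split=> [|_ [y _ <-]].
  apply: (@ideal_gen_sub _ _ (Ideal (multiples_is_ideal a))) => x /SaA[y ->].
  by exists y.
by apply: ideal_Mr; apply: ideal_genS.
Qed.

Lemma ideal_pow_generates (A : comPzRingType) (a : A) (I : ideal A) n :
  generates a I -> generates (a ^+ n) (ideal_pow I n).
Proof.
move=> aI; elim: n => [|n IHn].
  by apply/seteqP; split=> // x _; exists x; rewrite // expr0 mul1r.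
apply: ideal_gen_generates => [|_ [x Ix] [y Iy] <-].
  rewrite exprS; exists a; first by apply/(generatesP aI); exists 1; rewrite mulr1.
  by exists (a ^+ n) => //; apply/(generatesP IHn); exists 1; rewrite mulr1.
have [x' ->] := (generatesP aI x).1 Ix.
have [y' ->] := (generatesP IHn y).1 Iy.
by exists (x' * y'); rewrite exprS mulrACA.
Qed.

Lemma ideal_ext_generates (A B : comPzRingType) (f : {rmorphism A -> B}) a I :
  generates a I -> generates (f a) (ideal_ext f I).
Proof.
move=> aI; apply: ideal_gen_generates => [|_ [x Ix <-]].
  by exists a => //; apply/(generatesP aI); exists 1; rewrite mulr1.
have [y ->] := (generatesP aI x).1 Ix.
by exists (f y); rewrite rmorphM.
Qed.

Lemma ideal_ext_powP (A B : comPzRingType) (f : {rmorphism A -> B}) a I n x :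
  generates a I ->
  ideal_ext f (ideal_pow I n) x <-> exists y, x = f a ^+ n * y.
Proof.
move=> aI; rewrite -rmorphXn; apply: generatesP.
by apply/ideal_ext_generates/ideal_pow_generates.
Qed.

Lemma eq_subquot_pi (B : comPzRingType) (J K : ideal B) x y (Jx : J x) (Jy : J y) :
  x = y -> subquot_pi K Jx = subquot_pi K Jy.
Proof. by move=> xy; apply/subquot_piP; rewrite xy subrr; apply: ideal_0. Qed.

(** * Extending a surjective ring map in degree 0 to a graded isomorphism *)

Section GradedIsoOfMorphism.
Variables (A0 A B0 B : comPzRingType).
Variables (f : {rmorphism A0 -> A}) (g : {rmorphism B0 -> B}).
Variables (I : ideal A0) (J : ideal B0) (K : ideal B) (a : A0) (b : B0).
Hypotheses (aI : generates a I) (bJ : generates b J).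
Variable F : {rmorphism quot_ring K -> quot_ring (ideal_ext f I)}.

Local Notation IA n := (ideal_ext f (ideal_pow I n)).
Local Notation IB n := (ideal_ext g (ideal_pow J n)).
Local Notation piA := (quot_pi (ideal_ext f I)).
Local Notation piB := (quot_pi K).

Hypothesis F_surj : forall y, exists x, F x = y.
Hypothesis F_gr : forall n x y, F (piB x) = piA y ->
  IB n.+1 (g b ^+ n * x) <-> IA n.+1 (f a ^+ n * y).

(** The map sends the class of b^n x to that of a^n y whenever F x = y. Applied to differences, one
    direction of [F_gr] says that this is well defined and the other that it is injective.
    Surjectivity and compatibility with sums and products are inherited from F. *)
Lemma graded_iso_of_morphism :
  exists Phi : gradedIso (agr g J) (agr f I),
  forall n x y (hx : IB n (g b ^+ n * x)) (hy : IA n (f a ^+ n * y)),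
    F (piB x) = piA y ->
    Phi n (subquot_pi (IB n.+1) hx) = subquot_pi (IA n.+1) hy.
Proof.
have IAn n y : IA n (f a ^+ n * y) by apply/ideal_ext_powP; last by exists y.
have IBn n x : IB n (g b ^+ n * x) by apply/ideal_ext_powP; last by exists x.
have lift x : exists y, F (piB x) = piA y.
  by exists (quot_repr (F (piB x))); rewrite quot_reprK.
have liftB n (u : agr g J n) : exists x, subquot_pi (IB n.+1) (IBn n x) = u.
  have hu := subquot_reprP u.
  have [x ux] := (ideal_ext_powP g n _ bJ).1 hu.
  exists x; rewrite -[RHS](subquot_reprK hu); apply: eq_subquot_pi.
  by rewrite ux.
have liftA n (v : agr f I n) : exists y, subquot_pi (IA n.+1) (IAn n y) = v.
  have hv := subquot_reprP v.
  have [y vy] := (ideal_ext_powP f n _ aI).1 hv.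
  exists y; rewrite -[RHS](subquot_reprK hv); apply: eq_subquot_pi.
  by rewrite vy.
have eqAB n x x' y y' : F (piB x) = piA y -> F (piB x') = piA y' ->
    subquot_pi (IB n.+1) (IBn n x) = subquot_pi (IB n.+1) (IBn n x') <->
    subquot_pi (IA n.+1) (IAn n y) = subquot_pi (IA n.+1) (IAn n y').
  move=> xy xy'; rewrite !subquot_piP -!mulrBr; apply: F_gr.
  by rewrite !rmorphB /= xy xy'.
have phi_ n : {phi : agr g J n -> agr f I n | forall x y,
    F (piB x) = piA y ->
    phi (subquot_pi (IB n.+1) (IBn n x)) = subquot_pi (IA n.+1) (IAn n y)}.
  (* The value is characterised through all lifts x, y of the class u at once, so that the function
     obtained by choice does not depend on representatives. *)
  have ex u : exists v, forall x y, F (piB x) = piA y ->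
      subquot_pi (IB n.+1) (IBn n x) = u ->
      v = subquot_pi (IA n.+1) (IAn n y).
    have [x ux] := liftB n u; have [y xy] := lift x.
    exists (subquot_pi (IA n.+1) (IAn n y)) => x' y' xy' ux'.
    by apply/(eqAB _ x x') => //; rewrite ux ux'.
  have [phi phiE] := choice ex.
  by exists phi => x y xy; apply: phiE xy _.
pose phi n := projT1 (phi_ n).
have phiE n x y : F (piB x) = piA y ->
    phi n (subquot_pi (IB n.+1) (IBn n x)) = subquot_pi (IA n.+1) (IAn n y).
  exact: (projT2 (phi_ n)).
have phi_zmod n : zmod_morphism (phi n).
  move=> u v; have [x <-] := liftB n u; have [x' <-] := liftB n v.
  have [y xy] := lift x; have [y' xy'] := lift x'.
  rewrite (phiE _ _ _ xy) (phiE _ _ _ xy').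
  have xyB : F (piB (x - x')) = piA (y - y') by rewrite !rmorphB /= xy xy'.
  suff [-> ->] : subquot_pi (IB n.+1) (IBn n x) - subquot_pi (IB n.+1) (IBn n x') =
      subquot_pi (IB n.+1) (IBn n (x - x')) /\
      subquot_pi (IA n.+1) (IAn n y) - subquot_pi (IA n.+1) (IAn n y') =
      subquot_pi (IA n.+1) (IAn n (y - y')) by exact: phiE.
  split; apply/eqP; rewrite subr_eq; apply/eqP.
    rewrite -(subquot_piD _ _ _ (ideal_D (IBn n (x - x')) (IBn n x'))).
    by apply: eq_subquot_pi; rewrite mulrBr subrK.
  rewrite -(subquot_piD _ _ _ (ideal_D (IAn n (y - y')) (IAn n y'))).
  by apply: eq_subquot_pi; rewrite mulrBr subrK.
pose Phi_mx n := GRing.isZmodMorphism.Build _ _ (phi n) (phi_zmod n).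
pose Phi n : {additive agr g J n -> agr f I n} := HB.pack (phi n) (Phi_mx n).
have Phi_bij n : bijective (Phi n).
  have inj : injective (phi n).
    move=> u v; have [x <-] := liftB n u; have [x' <-] := liftB n v.
    have [y xy] := lift x; have [y' xy'] := lift x'.
    by rewrite (phiE _ _ _ xy) (phiE _ _ _ xy') => /(eqAB _ _ _ _ _ xy xy').
  have surj v : exists u, phi n u = v.
    have [y <-] := liftA n v; have [x0 x0y] := F_surj (piA y).
    exists (subquot_pi (IB n.+1) (IBn n (quot_repr x0))).
    by apply: phiE; rewrite quot_reprK.
  by have [psi psiK] := choice surj; exists psi => // u; apply: inj; rewrite psiK.
have Phi_one : Phi 0%N (gr_one (agr g J)) = gr_one (agr f I).
  have -> : gr_one (agr g J) = subquot_pi (IB 1%N) (IBn 0%N 1).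
    by apply: eq_subquot_pi; rewrite expr0 mulr1.
  rewrite [LHS](phiE 0%N 1 1) ?rmorph1 //.
  by apply: eq_subquot_pi; rewrite expr0 mulr1.
have Phi_mul m n (u : agr g J m) (v : agr g J n) :
    Phi (m + n)%N (gr_mul u v) = gr_mul (Phi m u) (Phi n v).
  have [x <-] := liftB m u; have [x' <-] := liftB n v.
  have [y xy] := lift x; have [y' xy'] := lift x'.
  have xyM : F (piB (x * x')) = piA (y * y') by rewrite !rmorphM /= xy xy'.
  rewrite /= (phiE _ _ _ xy) (phiE _ _ _ xy').
  rewrite (agr_mulE _ _ (ideal_ext_powD (IBn m x) (IBn n x'))).
  rewrite (agr_mulE _ _ (ideal_ext_powD (IAn m y) (IAn n y'))).
  transitivity (phi (m + n)%N (subquot_pi (IB (m + n).+1) (IBn (m + n)%N (x * x')))).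
    congr (phi _ _); apply: eq_subquot_pi.
    by rewrite mulrACA exprD.
  rewrite (phiE _ _ _ xyM); apply: eq_subquot_pi.
  by rewrite mulrACA exprD.
exists (GradedIso Phi_bij Phi_one Phi_mul) => n x y hx hy xy /=.
have -> : subquot_pi (IB n.+1) hx = subquot_pi (IB n.+1) (IBn n x).
  exact: eq_subquot_pi.
by rewrite (phiE _ _ _ xy); exact: eq_subquot_pi.
Qed.

End GradedIsoOfMorphism.

(** * The annihilator of gr^1 and the degree-0 part of a graded isomorphism *)

Lemma subquot_pi_eq0 (B : comPzRingType) (J K : ideal B) x (Jx : J x) :
  subquot_pi K Jx = 0 <-> K x.
Proof.
have <- : subquot_pi K (ideal_0 J) = 0.
  apply: (@addrI _ (subquot_pi K (ideal_0 J))).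
  rewrite -(subquot_piD _ _ _ (ideal_D (ideal_0 J) (ideal_0 J))) [RHS]addr0.
  by apply: eq_subquot_pi; rewrite addr0.
by rewrite subquot_piP subr0.
Qed.

(** This notion uses only the graded ring structure, so graded isomorphisms transport it; it is the
    trace that torsion leaves in the graded ring. *)
Definition kills_gr1 (G : gradedRing) n (u : G n) : Prop :=
  forall v : G 1%N, gr_mul u v = 0.

Lemma giso_kills_gr1 (G H : gradedRing) (Phi : gradedIso G H) n (u : G n) :
  kills_gr1 (Phi n u) <-> kills_gr1 u.
Proof.
split=> ann v.
  by apply: (bij_inj (giso_bij Phi (n + 1)%N)); rewrite giso_mul ann raddf0.
have [psi _ psiK] := giso_bij Phi 1%N.
by rewrite -[v]psiK -giso_mul ann raddf0.
Qed.

(** The class of f a generates gr^1, so it is enough to test the product with it. That product has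
    degree n + 1, hence it vanishes exactly when f a * x is a multiple of (f a)^(n+2). *)
Lemma agr_kills_gr1P (A B : comPzRingType) (f : {rmorphism A -> B}) (I : ideal A) a n x
    (hx : ideal_ext f (ideal_pow I n) x) : generates a I ->
  kills_gr1 (subquot_pi (ideal_ext f (ideal_pow I n.+1)) hx : agr f I n) <->
  exists z, f a * x = f a ^+ n.+2 * z.
Proof.
move=> aI; rewrite -(ideal_ext_powP f n.+2 (f a * x) aI).
have fa1 : ideal_ext f (ideal_pow I 1%N) (f a).
  by apply/(ideal_ext_powP f 1%N _ aI); exists 1; rewrite mulr1.
split=> [/(_ (subquot_pi _ fa1)) | ann v].
  rewrite /= (agr_mulE _ _ (ideal_ext_powD hx fa1)) subquot_pi_eq0.
  by rewrite addn1 mulrC.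
have hv := subquot_reprP v; rewrite -[v](subquot_reprK hv) /=.
rewrite (agr_mulE _ _ (ideal_ext_powD hx hv)); apply/subquot_pi_eq0.
have [y ->] := (ideal_ext_powP f 1%N _ aI).1 hv.
by rewrite addn1 mulrCA mulrA expr1; apply: ideal_Mr.
Qed.

Lemma giso_deg0P (A B A' B' : comPzRingType) (f : {rmorphism A -> B})
    (f' : {rmorphism A' -> B'}) (I : ideal A) (I' : ideal A')
    (Phi : gradedIso (agr f I) (agr f' I')) x y :
  giso_deg0 Phi (quot_pi _ x) = quot_pi _ y <->
  Phi 0%N (subquot_pi _ (@ideal_ext_pow0 _ _ f I x)) = subquot_pi _ (@ideal_ext_pow0 _ _ f' I' y).
Proof.
rewrite /giso_deg0 -!agr0_ofE.
by split=> [<-|->]; rewrite ?agr0_toK ?agr0_ofK.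
Qed.

(** * Torsion killed by a generator *)

(** Equivalently, Ann(a) meets aA trivially, or all a-power torsion is already killed by a. *)
Definition bounded_torsion (A : comPzRingType) (a : A) : Prop :=
  forall x, a * (a * x) = 0 -> a * x = 0.

Lemma bounded_torsionX (A : comPzRingType) (a : A) n x :
  bounded_torsion a -> a ^+ n.+1 * x = 0 -> a * x = 0.
Proof.
move=> ba; elim: n => [|n IHn]; first by rewrite expr1.
by rewrite !exprS -!mulrA => /ba; rewrite mulrA -exprS.
Qed.

Lemma bounded_torsion_cancel (A : comPzRingType) (a : A) n x y :
  bounded_torsion a -> a ^+ n.+1 * x = a ^+ n.+2 * y -> a * (x - a * y) = 0.
Proof.
move=> ba axy; apply: (@bounded_torsionX _ _ n) => //.
by rewrite mulrBr mulrA -exprSr axy subrr.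
Qed.

(** The generator b of the extended ideal need not be the image of a: in R_(i+1) it will be the p-th
    power of the image of a generator of I_1. *)
Lemma torsion_killedP (A B : comPzRingType) (f : {rmorphism A -> B}) (I : ideal A) a b :
  generates a I -> generates b (ideal_ext f I) ->
  (forall c x, I c -> torsion f I x -> f c * x = 0) ->
  bounded_torsion b /\ forall x, torsion f I x <-> b * x = 0.
Proof.
move=> aI bI killed.
have Ia : I a by apply/(generatesP aI); exists 1; rewrite mulr1.
have torb x : torsion f I x -> b * x = 0.
  have [u ->] : exists u, b = f a * u.
    apply/(generatesP (ideal_ext_generates f aI))/(generatesP bI).
    by exists 1; rewrite mulr1.
  by move=> xtor; rewrite mulrAC killed ?mul0r.
have fIb c : I c -> exists u, f c = b * u.
  by move=> Ic; apply/(generatesP bI); apply: ideal_genS; exists c.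
split=> [x bbx|x].
  (* If b^2 x = 0, the square of any element of the extended ideal kills x, so x is torsion and
     hence killed by b. *)
  apply: torb => c /fIb[u fc]; exists 2%N => //.
  by rewrite rmorphXn fc exprMn mulrAC expr2 -(mulrA b b x) bbx mul0r.
split=> [/torb //|bx c /fIb[u fc]].
by exists 1%N => //; rewrite expr1 fc mulrAC bx mul0r.
Qed.

(** * One level of the tower: torsion bijections and graded isomorphisms *)

Section OneLevel.
Variables (A0 A B0 B : comPzRingType).
Variables (f : {rmorphism A0 -> A}) (g : {rmorphism B0 -> B}).
Variables (I : ideal A0) (J : ideal B0) (K : ideal B) (a : A0) (b : B0) (p : nat).
Hypotheses (p_gt0 : (0 < p)%N) (aI : generates a I) (bJ : generates b J).
Hypothesis bK : generates (g b ^+ p) K.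
Hypotheses (tor_fa : bounded_torsion (f a)) (tor_gb : bounded_torsion (g b ^+ p)).
Variable F : {rmorphism quot_ring K -> quot_ring (ideal_ext f I)}.

Local Notation IA n := (ideal_ext f (ideal_pow I n)).
Local Notation IB n := (ideal_ext g (ideal_pow J n)).
Local Notation piA := (quot_pi (ideal_ext f I)).
Local Notation piB := (quot_pi K).

Lemma quot_pi_ext_eq0 y : piA y = 0 <-> exists z, y = f a * z.
Proof.
rewrite -(generatesP (ideal_ext_generates f aI)) -(rmorph0 piA).
by rewrite quot_piP subr0.
Qed.

Lemma quot_proj_pi x : quot_proj (ideal_ext g J) (piB x) = quot_pi (ideal_ext g J) x.
Proof.
apply: (quot_mapE (f := idfun)) => {}x /(generatesP bK)[y ->] /=.
rewrite -(prednK p_gt0) exprS -mulrA; apply/(generatesP (ideal_ext_generates g bJ)).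
by exists (g b ^+ p.-1 * y).
Qed.

(** This translates the kernel condition of a perfectoid tower into elements. Lifting from B/K to B
    costs a multiple of b^p, which is again a multiple of b as p > 0. *)
Lemma kernel_ideal_extP : (forall x, F (piB x) = 0 <-> exists z, x = g b * z) <->
  [set x | F x = 0] = ideal_ext (piB \o g) J :> set _.
Proof.
have gJ := ideal_ext_generates (piB \o g : {rmorphism B0 -> quot_ring K}) bJ.
split=> [kerF|kerF x].
  apply/seteqP; split=> x; rewrite -[x]quot_reprK /=; [case/kerF=> z ->|].
    by apply/(generatesP gJ); exists (piB z); rewrite rmorphM.
  case/(generatesP gJ)=> z; rewrite -[z]quot_reprK /= -rmorphM => ->.
  by apply/kerF; exists (quot_repr z).
have -> : (F (piB x) = 0) = [set x | F x = 0] (piB x) by [].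
rewrite kerF; split=> [/(generatesP gJ)[z]|[z ->]]; last first.
  by apply/(generatesP gJ); exists (piB z); rewrite rmorphM.
rewrite -[z]quot_reprK /= -rmorphM => /quot_piP/(generatesP bK)[y /eqP].
rewrite subr_eq => /eqP ->; rewrite -(prednK p_gt0) exprS -mulrA -mulrDr.
by eexists.
Qed.

(** The compatibility required by [graded_iso_of_morphism] is the kernel condition in degree 0. In
    positive degree n, b^n x lies in b^(n+1) B exactly when x is a torsion element plus a multiple
    of b, and similarly for y and a. These decompositions correspond under F, as [Ftor] matches the
    torsion and F kills the multiples of b. *)
Lemma graded_iso_of_torsion_bij (Ftor : B -> A) :
  (forall y, exists x, F x = y) ->
  (forall x, F (piB x) = 0 <-> exists z, x = g b * z) ->
  set_bij [set x | g b ^+ p * x = 0] [set y | f a * y = 0] Ftor ->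
  (forall x, g b ^+ p * x = 0 -> F (piB x) = piA (Ftor x)) ->
  exists Phi : gradedIso (agr g J) (agr f I),
    forall x, F x = giso_deg0 Phi (quot_proj (ideal_ext g J) x).
Proof.
move=> F_surj kerF [Ftor_fun Ftor_inj Ftor_surj] FtorE.
have torA0 y : f a * y = 0 -> piA y = 0 -> y = 0.
  by move=> ay /quot_pi_ext_eq0[z yE]; rewrite yE in ay *; apply: tor_fa.
have torB0 x : g b ^+ p * x = 0 -> F (piB x) = 0 -> x = 0.
  have tor0 : g b ^+ p * 0 = 0 by rewrite mulr0.
  move=> bx Fx; apply: Ftor_inj; rewrite ?inE //=.
  rewrite [LHS]torA0 ?[RHS]torA0 -?FtorE ?rmorph0 //; exact: Ftor_fun.
(* For torsion x, the element b x is torsion and lies in the kernel of F, so it vanishes. Thus b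
   itself, and not only b^p, kills the torsion of B. *)
have torB x : g b ^+ p * x = 0 -> g b * x = 0.
  move=> bx; apply: torB0; first by rewrite mulrCA bx mulr0.
  by apply/kerF; exists x.
have F_gr n x y : F (piB x) = piA y ->
    IB n.+1 (g b ^+ n * x) <-> IA n.+1 (f a ^+ n * y).
  move=> xy; rewrite (ideal_ext_powP g _ _ bJ) (ideal_ext_powP f _ _ aI); case: n => [|n].
    rewrite !expr0 !expr1 !mul1r; apply: iff_trans (iff_sym (kerF x)) _; rewrite xy.
    exact: quot_pi_ext_eq0.
  have -> : (exists z, g b ^+ n.+1 * x = g b ^+ n.+2 * z) <->
      exists z t, x = t + g b * z /\ g b ^+ p * t = 0.
    split=> [[z bxz]|[z [t [-> bt]]]].
      exists z, (x - g b * z); split; first by rewrite subrK.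
      (* The hypothesis bounds torsion for b^p, so the power used is (b^p)^(n+1), a multiple of
         b^(n+1) because p > 0. *)
      apply: (@bounded_torsionX _ _ n) => //; rewrite -exprM mulnS.
      have -> : (p + p * n = (p * n.+1 - n.+1) + n.+1)%N.
        by rewrite subnK ?leq_pmull // mulnS.
      by rewrite exprD -mulrA mulrBr mulrA -exprSr bxz subrr mulr0.
    exists z; rewrite mulrDr mulrA -exprSr.
    by rewrite [g b ^+ n.+1 * t]mulrC exprS mulrA [t * _]mulrC torB // mul0r add0r.
  have -> : (exists z, f a ^+ n.+1 * y = f a ^+ n.+2 * z) <->
      exists z t, y = t + f a * z /\ f a * t = 0.
    split=> [[z ayz]|[z [t [-> at0]]]].
      exists z, (y - f a * z); split; first by rewrite subrK.
      exact: bounded_torsion_cancel ayz.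
    exists z; rewrite mulrDr mulrA -exprSr.
    by rewrite [f a ^+ n.+1 * t]mulrC exprS mulrA [t * _]mulrC at0 mul0r add0r.
  (* The torsion part is moved forward by [Ftor], and back by its surjectivity; the remainder maps
     to 0 modulo a, or lies in the kernel of F. *)
  split=> [[z [t [xE bt]]]|[z [t [yE at0]]]].
    have : piA (y - Ftor t) = 0.
      rewrite rmorphB /= -FtorE // -xy xE rmorphD rmorphD /= addrAC subrr add0r.
      by apply/kerF; exists z.
    case/quot_pi_ext_eq0=> w /eqP; rewrite subr_eq addrC => /eqP yE.
    by exists w, (Ftor t); split=> //; apply: Ftor_fun.
  have [s /= bs st] := Ftor_surj _ at0.
  have : F (piB (x - s)) = 0.
    rewrite !rmorphB /= (FtorE s) // st xy yE rmorphD addrAC subrr add0r.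
    by apply/quot_pi_ext_eq0; exists z.
  case/kerF=> w /eqP; rewrite subr_eq addrC => /eqP xE.
  by exists w, s.
have [Phi PhiE] := graded_iso_of_morphism aI bJ F_surj F_gr.
exists Phi => x; rewrite -[x]quot_reprK quot_proj_pi.
set x' := quot_repr x; have [y xy] : exists y, F (piB x') = piA y.
  by exists (quot_repr (F (piB x'))); rewrite quot_reprK.
rewrite xy; apply/esym/giso_deg0P.
have hx : IB 0%N (g b ^+ 0 * x') by apply: ideal_ext_pow0.
have hy : IA 0%N (f a ^+ 0 * y) by apply: ideal_ext_pow0.
have := PhiE 0%N x' y hx hy xy.
rewrite (eq_subquot_pi _ hx (@ideal_ext_pow0 _ _ g J x')) ?mul1r //.
by rewrite (eq_subquot_pi _ hy (@ideal_ext_pow0 _ _ f I y)) ?mul1r.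
Qed.

(** * From a graded isomorphism back to the kernel, the image and the torsion *)

Section FromGradedIso.
Variable Phi : gradedIso (agr g J) (agr f I).
Hypothesis FE : forall x, F x = giso_deg0 Phi (quot_proj (ideal_ext g J) x).

Lemma deg0P x y : F (piB x) = piA y <->
  Phi 0%N (subquot_pi _ (@ideal_ext_pow0 _ _ g J x)) = subquot_pi _ (@ideal_ext_pow0 _ _ f I y).
Proof. by rewrite FE quot_proj_pi giso_deg0P. Qed.

Lemma deg0_surj y : exists x, F x = y.
Proof.
have [psi _ psiK] := giso_bij Phi 0%N.
pose u := psi (agr0_of y); exists (piB (subquot_repr u)).
rewrite -[y]quot_reprK; apply/deg0P.
rewrite (eq_subquot_pi _ _ (subquot_reprP u)) // subquot_reprK psiK.
by rewrite -agr0_ofE quot_reprK.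
Qed.

Lemma deg0_eq0 x : F (piB x) = 0 <-> exists z, x = g b * z.
Proof.
rewrite -(rmorph0 piA) deg0P; have -> : subquot_pi (IA 1%N) (@ideal_ext_pow0 _ _ f I 0) = 0.
  by apply/subquot_pi_eq0; apply: ideal_0.
rewrite -(raddf0 (Phi 0%N)).
have -> : forall u v, Phi 0%N u = Phi 0%N v <-> u = v.
  by move=> u v; split=> [/(bij_inj (giso_bij Phi 0%N))|->].
by rewrite subquot_pi_eq0 (ideal_ext_powP g 1%N x bJ).
Qed.

(** Both sides say that a degree-0 class annihilates gr^1, a property that Phi preserves; the
    exponent 2 appears because the products lie in the quotient of the ideal by its square. *)
Lemma deg0_kills x y : F (piB x) = piA y ->
  (exists z, g b * x = g b ^+ 2 * z) <-> (exists z, f a * y = f a ^+ 2 * z).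
Proof.
move/deg0P=> xy.
rewrite -(agr_kills_gr1P (@ideal_ext_pow0 _ _ g J x) bJ).
by rewrite -(agr_kills_gr1P (@ideal_ext_pow0 _ _ f I y) aI) -(giso_kills_gr1 Phi) xy.
Qed.

(* gr^1 annihilates nothing in positive degree: for f this holds because
   bounded torsion meets the image of f a trivially, and Phi transports it to g. *)
Lemma gr_generator_cancel n x : (exists z, g b ^+ n.+2 * x = g b ^+ n.+3 * z) ->
  exists z, g b ^+ n.+1 * x = g b ^+ n.+2 * z.
Proof.
have hx : IB n.+1 (g b ^+ n.+1 * x) by apply/(ideal_ext_powP g n.+1 _ bJ); exists x.
have -> : g b ^+ n.+2 * x = g b * (g b ^+ n.+1 * x) by rewrite exprS mulrA.
rewrite -(agr_kills_gr1P hx bJ) -(giso_kills_gr1 Phi).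
set v := Phi _ _; have hv := subquot_reprP v; rewrite -[v](subquot_reprK hv).
rewrite (agr_kills_gr1P hv aI) -(ideal_ext_powP g n.+2 _ bJ) => ann.
apply/(subquot_pi_eq0 _ hx)/(bij_inj (giso_bij Phi n.+1)); rewrite raddf0 -/v.
rewrite -[v](subquot_reprK hv); apply/subquot_pi_eq0/(ideal_ext_powP f n.+2 _ aI).
have [y vy] := (ideal_ext_powP f n.+1 _ aI).1 hv; rewrite vy in ann *.
case: ann => z; rewrite mulrA -exprS => /(bounded_torsion_cancel tor_fa) ayz.
exists z; apply/eqP; rewrite -subr_eq0 [f a ^+ n.+2]exprSr -mulrA -mulrBr.
by rewrite exprSr -mulrA ayz mulr0.
Qed.

(** Repeated cancellation in positive degrees shows that a torsion multiple of b is divisible by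
    every power of b. Once it is b^p z, bounded torsion for b^p makes it zero. *)
Lemma torsion_mul_eq0 y : g b ^+ p * (g b * y) = 0 -> g b * y = 0.
Proof.
move=> by0.
have gr_cancelD j n x : g b ^+ (j + n.+1) * x = 0 -> exists z, g b ^+ n.+1 * x = g b ^+ n.+2 * z.
  (* The zero product is read as b^(j+n+2) times 0, which starts a descent of j cancellations. *)
  move=> bx; have : exists z, g b ^+ (j + n.+1) * x = g b ^+ (j + n.+2) * z.
    by exists 0; rewrite bx mulr0.
  by elim: j {bx} => [//|j IHj]; rewrite !addSn !addnS => /gr_generator_cancel; rewrite -!addnS.
have div k : exists z, g b * y = g b ^+ k.+1 * z.
  elim: k => [|k [z byz]]; first by exists y.
  by rewrite byz; apply: (gr_cancelD p); rewrite exprD -mulrA -byz.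
have [z byz] := div p.-1; rewrite prednK // in byz.
by rewrite byz in by0 *; apply: tor_gb.
Qed.

(** A torsion x satisfies b x = 0, so its class annihilates gr^1, and so does that of any lift y of
    F x. Then a y = a^2 z, and y - a z is a torsion lift of F x; it is the only one because torsion
    meets aA trivially. Surjectivity is the same argument from A to B. *)
Lemma torsion_bij_of_graded_iso : exists2 Ftor : B -> A,
  set_bij [set x | g b ^+ p * x = 0] [set y | f a * y = 0] Ftor &
  forall x, g b ^+ p * x = 0 -> F (piB x) = piA (Ftor x).
Proof.
have uniqA y : f a * y = 0 -> piA y = 0 -> y = 0.
  by move=> ay /quot_pi_ext_eq0[z yE]; rewrite yE in ay *; apply: tor_fa.
have uniqB x : g b ^+ p * x = 0 -> F (piB x) = 0 -> x = 0.
  by move=> bx /deg0_eq0[z xE]; rewrite xE in bx *; apply: torsion_mul_eq0.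
have ex x : exists y, g b ^+ p * x = 0 -> f a * y = 0 /\ F (piB x) = piA y.
  (* Outside the torsion the value is irrelevant and is set to 0. *)
  have [bx|] := EM (g b ^+ p * x = 0); last by exists 0.
  pose y := quot_repr (F (piB x)); have xy : F (piB x) = piA y by rewrite quot_reprK.
  have [|z ayz] := (deg0_kills xy).1.
    by exists 0; rewrite mulr0; apply: torsion_mul_eq0; rewrite mulrCA bx mulr0.
  exists (y - f a * z) => _; split.
    by apply: (@bounded_torsion_cancel _ _ 0%N) => //; rewrite expr1.
  rewrite rmorphB xy -[LHS]subr0; congr (_ - _); apply/esym/quot_pi_ext_eq0.
  by exists z.
have [Ftor FtorP] := choice ex; exists Ftor => [|x /FtorP[]//].
split=> [x /FtorP[]//|x x'|y /= ay].
  rewrite !inE /= => bx bx' xx'; have [_ xF] := FtorP _ bx; have [_ xF'] := FtorP _ bx'.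
  apply/eqP; rewrite -subr_eq0; apply/eqP/uniqB; first by rewrite mulrBr bx bx' subrr.
  by rewrite !rmorphB /= xF xF' xx' subrr.
(* Any preimage x of y modulo a is corrected by a multiple of b, which F does not see, to become
   torsion. *)
have [x0] := deg0_surj (piA y); rewrite -[x0]quot_reprK; set x := quot_repr x0 => xy.
have [|z bxz] := (deg0_kills xy).2; first by exists 0; rewrite ay mulr0.
have bxz0 : g b ^+ p * (x - g b * z) = 0.
  rewrite -(prednK p_gt0) exprSr -mulrA mulrBr mulrA -expr2 bxz subrr.
  by rewrite mulr0.
exists (x - g b * z) => //; have [aF FF] := FtorP _ bxz0.
apply/eqP; rewrite -subr_eq0; apply/eqP/uniqA; first by rewrite mulrBr aF ay subrr.
rewrite rmorphB /= -FF -xy !rmorphB /= addrAC subrr add0r.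
by apply/eqP; rewrite oppr_eq0; apply/eqP/deg0_eq0; exists z.
Qed.

End FromGradedIso.
End OneLevel.

(** * Generators along the tower, and the equivalence level by level *)

Lemma tower_map1E (T : tower) i x :
  tower_map1 T i (tower_map T 1 x) = tower_map T i.+1 x.
Proof. by elim: i => [//|i IHi]; apply: (congr1 (tower_trans T i.+1) IHi). Qed.

(** In R_1, b and the image of a are multiples of each other, and this persists in R_(i+1). *)
Lemma tower_ideal_generates (T : tower) (I0 : ideal (T 0%N)) a b i :
  generates a I0 -> generates b (tower_ideal I0 1) ->
  generates (tower_map1 T i b) (tower_ideal I0 i.+1).
Proof.
move=> aI0 bI; have aI n := ideal_ext_generates (tower_map T n) aI0.
have /(generatesP (aI 1%N))[u bu] : tower_ideal I0 1 b.
  by apply/(generatesP bI); exists 1; rewrite mulr1.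
have /(generatesP bI)[v av] : tower_ideal I0 1 (tower_map T 1 a).
  by apply/(generatesP (aI 1%N)); exists 1; rewrite mulr1.
apply/seteqP; split=> [x /(generatesP (aI i.+1))[y ->]|_ [y _ <-]].
  by exists (tower_map1 T i v * y); rewrite // mulrA -rmorphM -av tower_map1E.
rewrite bu rmorphM tower_map1E -mulrA; apply/(generatesP (aI i.+1)).
by exists (tower_map1 T i u * y).
Qed.

Unset Implicit Arguments.

Theorem theorem1 (p : nat) (p_pr : prime p) (T : tower) (I0 : ideal (T 0%N))
    (I0_principal : principal_ideal I0) :
  perfectoid_tower p I0 <->
  exists I1 : ideal (T 1%N), principal_ideal I1 /\
  exists F : forall i, {rmorphism tower_quot I0 i.+1 -> tower_quot I0 i},
    [/\ (* (0) *) forall i,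
          [/\ injective (tower_bar (I0 := I0) (i := i)),
              p%:R = 0 :> tower_quot I0 i.+1,
              forall x : tower_quot I0 i.+1, x ^+ p = tower_bar (F i x) &
              torsion_killed I0 i],
        (* (1) *) (ideal_pow I1 p = tower_ideal I0 1%N :> set (T 1%N)) /\
          (forall i, zariskian (tower_ideal I0 i)) &
        (* (2) *) forall i,
          exists Phi : gradedIso (agr (tower_map1 T i) I1) (agr (tower_map T i) I0),
            forall x : tower_quot I0 i.+1,
              F i x = giso_deg0 Phi
                (quot_proj (ideal_ext (tower_map1 T i) I1) x)].
Proof.
have [a aI0] := I0_principal; have p_gt0 := prime_gt0 p_pr.
have genA i := ideal_ext_generates (tower_map T i) aI0.
have genK I1 b i : generates b I1 -> ideal_pow I1 p = tower_ideal I0 1%N :> set (T 1%N) ->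
    generates (tower_map1 T i b ^+ p) (tower_ideal I0 i.+1).
  move=> bI1 I1p; rewrite -rmorphXn; apply: tower_ideal_generates aI0 _.
  by rewrite /generates -I1p; apply: ideal_pow_generates.
have torP i c : generates c (tower_ideal I0 i) -> torsion_killed I0 i ->
    bounded_torsion c /\ tower_torsion I0 i = [set x | c * x = 0].
  move=> ci /(torsion_killedP aI0 ci)[bc torc]; split=> //.
  by apply/seteqP; split=> x /torc.
split=> [[H F_surj zar _ [I1 [[b bI1] I1p kerF]] killed Ftor]|].
  exists I1; split; first by exists b.
  pose F i : {rmorphism tower_quot I0 i.+1 -> tower_quot I0 i} :=
    HB.pack (@frob_proj p T I0 H i)
      (GRing.isZmodMorphism.Build _ _ _ (@frob_proj_zmod p T I0 p_pr H i))
      (GRing.isMonoidMorphism.Build _ _ _ (@frob_proj_monoid p T I0 H i)).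
  exists F; split=> // i.
    split=> //; first exact: (pi_inj H (i := i)).
      exact: (tower_quot_p H).
    by move=> x; rewrite frob_projE.
  have [ba torA] := torP i _ (genA i) (killed i).
  have [bb torB] := torP i.+1 _ (genK _ _ i bI1 I1p) (killed i.+1).
  have [Ftor_i] := Ftor i; rewrite torA torB => Ftor_bij FtorE.
  apply: (graded_iso_of_torsion_bij p_gt0 aI0 bI1 (genK _ _ i bI1 I1p) ba bb
            (F := F i) (F_surj i) _ Ftor_bij FtorE).
  by apply/(kernel_ideal_extP p_gt0 bI1 (genK _ _ i bI1 I1p)); apply: kerF.
case=> I1 [[b bI1] [F [F0 [I1p zar] FPhi]]].
have bar_inj i : injective (@tower_bar T I0 i) by case: (F0 i).
have FE i x : tower_bar (F i x) = x ^+ p by case: (F0 i).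
have killed i : torsion_killed I0 i by case: (F0 i).
have H : purely_inseparable p I0.
  split=> // [|i _ [x _ <-]]; last by exists (F i x).
  (* Condition (0) gives p = 0 only from level 1 on; injectivity of the first transition map modulo
     I_0 brings it down to level 0. *)
  have p0 : p%:R = 0 :> tower_quot I0 0%N.
    by apply: bar_inj; rewrite rmorph_nat rmorph0; case: (F0 0%N).
  (* I_0 and its extension along the identity of R_0 have the same generator a. *)
  apply/(generatesP aI0)/(generatesP (genA 0%N)).
  by rewrite -[_%:R]subr0; apply/quot_piP; rewrite rmorph0 rmorph_nat.
(* Injectivity of the transition maps modulo I_0 identifies the given F with the Frobenius
   projection. *)
have frobE i : @frob_proj p T I0 H i =1 F i.
  by move=> x; rewrite -(frob_proj_unique H (FE i)).
have level i := genK _ _ i bI1 I1p.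
exists H => //.
- move=> i y; have [Phi PhiE] := FPhi i.
  have [x <-] := deg0_surj p_gt0 bI1 (level i) PhiE y.
  by exists x; apply: frobE.
- exists I1; split=> [||i] //; first by exists b.
  have [Phi PhiE] := FPhi i.
  have /(kernel_ideal_extP p_gt0 bI1 (level i)) <- := deg0_eq0 p_gt0 bI1 (level i) PhiE.
  by apply/seteqP; split=> x /=; rewrite frobE.
- move=> i; have [Phi PhiE] := FPhi i.
  have [ba torA] := torP i _ (genA i) (killed i).
  have [bb torB] := torP i.+1 _ (level i) (killed i.+1).
  rewrite torA torB.
  have [Ftor Ftor_bij FtorE] := torsion_bij_of_graded_iso p_gt0 aI0 bI1 (level i) ba bb PhiE.
  by exists Ftor => // x xtor; rewrite [LHS]frobE; apply: FtorE.
Qed.
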